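(* Let $\lambda$ be a regular uncountable cardinal and let $\kappa$ be a cardinal with $2\le\kappa<\lambda$. Assume that $\otimes^\kappa_\lambda$ holds, or just that $\oplus^\kappa_\lambda$ holds (both defined in the context). Then there is a symmetric two-place function $c$ from $\lambda$ to $\aleph_0$ such that: whenever $\langle w_i:i<\lambda\rangle$ is a sequence of pairwise disjoint non-empty subsets of $\lambda$ with $|w_i|<\kappa$ for all $i<\lambda$, and $n<\omega$, there is $Y\in[\lambda]^\lambda$ such that for all $i<j$ from $Y$: every element of $w_i$ is smaller than every element of $w_j$, and $c(\alpha,\beta)>n$ for all $\alpha\in w_i$ and $\beta\in w_j$.
   Context: $[\lambda]^\lambda$ is the family of subsets of $\lambda$ of cardinality $\lambda$. For a set $C$ of ordinals, $\mathrm{acc}(C)=\{\alpha\in C:\alpha=\sup(\alpha\cap C)\}$ and $\mathrm{nacc}(C)=C\setminus\mathrm{acc}(C)$. ''Inaccessible'' means weakly inaccessible (uncountable regular limit cardinal); $\lambda$ is Mahlo if it is inaccessible and the set of inaccessibles below $\lambda$ is stationary in $\lambda$. Put $S^\lambda_{\mathrm{in}}=\{\delta<\lambda:\delta\text{ is inaccessible}\}$ and $S^\lambda_{\ge\kappa}=\{\delta<\lambda:\mathrm{cf}(\delta)\ge\kappa\}$. $\otimes^\kappa_\lambda$ (for $\lambda$ Mahlo, $\kappa<\lambda$): there is $\bar C=\langle C_\delta:\delta\in S^\lambda_{\mathrm{in}}\rangle$ with each $C_\delta$ a club of $\delta$, such that for every club $E$ of $\lambda$ there is $\delta\in\mathrm{acc}(E)\cap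 S^\lambda_{\mathrm{in}}$ with $\mathrm{cf}(\delta)\ge\kappa$ such that for no $\zeta<\kappa$ and $\alpha_\varepsilon\in S^\lambda_{\mathrm{in}}$ ($\varepsilon<\zeta$) is $(\mathrm{nacc}(E)\cap\delta)\setminus\bigcup_{\varepsilon<\zeta}C_{\alpha_\varepsilon}$ bounded in $\delta$. $\oplus^\kappa_\lambda$ (for $\lambda$ regular uncountable, $\kappa<\lambda$): there is $\bar C=\langle C_\delta:\delta\in S\rangle$, where $S=\{\delta<\lambda:\delta\text{ a limit ordinal}\}$ and each $C_\delta$ is a club of $\delta$, such that for every club $E$ of $\lambda$ there is $\delta\in\mathrm{acc}(E)$ with $\mathrm{cf}(\delta)\ge\kappa$ such that for no $\zeta<\kappa$ and $\alpha_\varepsilon\in S$ ($\varepsilon<\zeta$) is $(S^\lambda_{\ge\kappa}\cap E\cap\delta)\setminus\bigcup_{\varepsilon<\zeta}C_{\alpha_\varepsilon}$ bounded in $\delta$. *)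

(* Defs.v *)
From HB Require Import structures.
From mathcomp Require Import all_boot all_order.
From mathcomp Require Import all_classical.
Set Implicit Arguments.
Unset Strict Implicit.
Unset Printing Implicit Defensive.
Import Order.TTheory.
Local Open Scope classical_set_scope.
Local Open Scope card_scope.
Local Open Scope order_scope.

(* The ordinal lambda is a well-ordered type L.  The ordinals below lambda are
   the elements of L, and an ordinal <= lambda is identified, as a von Neumann
   ordinal, with the initial segment D : set L of its predecessors: D is
   [below a] for a < lambda, and [setT] for lambda itself.  The definitions
   below make sense when L is well ordered and D is such a segment. *)

Section Ordinals.
Context {d : Order.disp_t} {L : orderType d}.
Implicit Types (a b x y delta : L) (A C D E S : set L).

Definition below a : set L := [set x | x < a].

Definition card_lt T U (A : set T) (B : set U) : Prop :=
  A #<= B /\ ~ (B #<= A).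

Definition is_cardinal D : Prop := forall a, D a -> ~ (below a #= D).

(* The cardinal |A| as a von Neumann ordinal: x < |A| iff |A| is not <= |x|. *)
Definition ordcard A : set L := [set x | ~ (A #<= below x)].

Definition cofinal A D : Prop :=
  A `<=` D /\ (forall x, D x -> exists2 y, A y & x <= y).

(* The minimum of a set of von Neumann ordinals is its intersection. *)
Definition cf D : set L := \bigcap_(A in [set A | cofinal A D]) ordcard A.

Definition regular D : Prop :=
  [/\ is_cardinal D, infinite_set D & cf D = D].

Definition limit_cardinal D : Prop :=
  is_cardinal D /\
  (forall a, D a -> is_cardinal (below a) ->
     exists b, [/\ D b, is_cardinal (below b) & a < b]).

Definition inaccessible D : Prop :=
  [/\ ~ countable D, regular D & limit_cardinal D].

(* 0 is not a limit ordinal. *)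
Definition limit_ordinal a : Prop :=
  below a !=set0 /\ (forall x, x < a -> exists2 y, x < y & y < a).

Definition acc C : set L := [set a | C a /\ supremums (C `&` below a) a].

Definition nacc C : set L := C `\` acc C.

Definition club C D : Prop :=
  cofinal C D /\
  (forall a, D a -> C `&` below a !=set0 ->
     supremums (C `&` below a) a -> C a).

Definition stationary S D : Prop :=
  S `<=` D /\ (forall C, club C D -> S `&` C !=set0).

Definition bounded_in A delta : Prop :=
  exists2 b, b < delta & ubound A b.

Definition S_in : set L := [set delta | inaccessible (below delta)].

Definition S_ge (kappa : L) : set L :=
  [set delta | below kappa `<=` cf (below delta)].

Definition S_lim : set L := [set delta | limit_ordinal delta].

Definition is_Mahlo : Prop := inaccessible [set: L] /\ stationary S_in [set: L].

(* A sequence <C_delta : delta in S> is a function on all of L of which only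
   the values on S are used, and likewise <alpha_eps : eps < zeta>. *)
Definition otimes (kappa : L) : Prop :=
  exists C : L -> set L,
    (forall delta, S_in delta -> club (C delta) (below delta)) /\
    (forall E, club E [set: L] ->
       exists delta,
         [/\ acc E delta, S_in delta, S_ge kappa delta &
             ~ exists (zeta : L) (alpha : L -> L),
                 [/\ zeta < kappa,
                     (forall eps, eps < zeta -> S_in (alpha eps)) &
                     bounded_in
                       ((nacc E `&` below delta) `\`
                          \bigcup_(eps in below zeta) C (alpha eps))
                       delta]]).

Definition oplus (kappa : L) : Prop :=
  exists C : L -> set L,
    (forall delta, S_lim delta -> club (C delta) (below delta)) /\
    (forall E, club E [set: L] ->
       exists delta,
         [/\ acc E delta, S_ge kappa delta &
             ~ exists (zeta : L) (alpha : L -> L),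
                 [/\ zeta < kappa,
                     (forall eps, eps < zeta -> S_lim (alpha eps)) &
                     bounded_in
                       ((S_ge kappa `&` E `&` below delta) `\`
                          \bigcup_(eps in below zeta) C (alpha eps))
                       delta]]).

End Ordinals.

Arguments is_Mahlo {d} L.

(* Main.v *)
Require Import Defs.
From HB Require Import structures.
From mathcomp Require Import all_boot all_order.
From mathcomp Require Import all_classical.
Set Implicit Arguments.
Unset Strict Implicit.
Unset Printing Implicit Defensive.
Import Order.TTheory.
Local Open Scope classical_set_scope.
Local Open Scope card_scope.
Local Open Scope order_scope.

(**
Fix a cofinal set [C b] in every ordinal [b] and walk down from [b] to [a < b]
through the least element of the current ladder that is at least [a].  The
colour of [{a, b}] is the number [rho a b] of steps.

Let [w x] be a small set of ordinals above [x], for each [x].  For a point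
[delta] provided by the guessing principle, the walks from all the [b] in
[w delta] to ordinals in a final segment of [delta] pass through ordinals
[b' >= delta] indexing the guessing sequence.  As the ladders [C b'] do not
cover the prescribed subset of [delta], there is a [gamma < delta] of cofinality
at least [kappa], in any given club, lying outside all of them.  These ladders
are bounded in [gamma], hence the walks to ordinals in some [(eta, gamma)] all
make a step from [b'] to a point [h b >= gamma].  Pressing down makes [eta]
independent of [gamma]; the sets of the [h b] form a new family, and induction
on [n] gives walks of length at least [n] on unboundedly many members of the
family.

In the case of otimes, the guessing principle is applied to the set of members
and limits of [E `&` S_ge kappa], whose non-accumulation points all have
cofinality at least [kappa].
*)

(** * Comparison of cardinalities *)

Lemma card_le_inj T U (A : set T) (B : set U) (f : T -> U) :
  {in A &, injective f} -> f @` A `<=` B -> A #<= B.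
Proof.
move=> fI fAB; have := inj_card_eq fI; rewrite card_eq_le => /andP[_ Af].
exact: card_le_trans Af (subset_card_le fAB).
Qed.

Lemma card_le_cover T U (A : set T) (B : set U) (t0 : T) :
  A #<= B -> exists g : U -> T, A `<=` g @` B.
Proof.
move=> /ocard_geP[f]; exists (fun u => odflt t0 (f u)) => a Aa.
have [|u Bu fu] := @surj _ _ _ _ f (Some a); first by exists a.
by exists u => //; rewrite fu.
Qed.

(** * Recursion, cofinality and closed sets in a well order *)

Section WellOrder.
Context {d : Order.disp_t} {L : orderType d}.
Context (L_wf : well_founded (fun x y : L => x < y)).
Implicit Types (a b x y z delta gamma kappa : L) (A B C D E : set L).

Lemma least_element A : A !=set0 -> exists2 m, A m & lbound A m.
Proof.
case=> a; elim/(well_founded_ind L_wf): a => a IH Aa.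
have [[b Ab ba]|nb] := pselect (exists2 b, A b & b < a); first exact: IH Ab.
by exists a => // b Ab; rewrite leNgt; apply/negP => ba; apply: nb; exists b.
Qed.

Lemma wf_recursion T (t0 : T) (G : L -> (L -> T) -> T) :
  (forall x f g, (forall y, y < x -> f y = g y) -> G x f = G x g) ->
  exists h, forall x, h x = G x h.
Proof.
move=> Gext.
pose F x (rec : forall y, y < x -> T) :=
  G x (fun y => if pselect (y < x) is left p then rec y p else t0).
exists (Fix L_wf (fun=> T) F) => x.
rewrite Fix_eq; last first.
  move=> y f g fg; apply: Gext => z zy.
  by case: pselect => // p; rewrite fg.
by apply: Gext => y yx; case: pselect.
Qed.

Lemma segment_card_le T (B : set T) D :
  (forall x y, D x -> y < x -> D y) ->
  (forall x, D x -> ~ (B #<= below x)) -> D #<= B.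
Proof.
move=> Dseg Bbig.
have [->|/set0P[x0 Dx0]] := eqVneq D set0; first exact: card_ge0.
have [t0 _] : B !=set0.
  apply/set0P/eqP => B0; apply: (Bbig _ Dx0); rewrite B0; exact: card_ge0.
pose G x (f : L -> T) :=
  if pselect (exists2 t, B t & ~ (f @` below x) t) is left p
  then projT1 (cid2 p) else t0.
have Gext x f g : (forall y, y < x -> f y = g y) -> G x f = G x g.
  move=> fg; rewrite /G; suff -> : f @` below x = g @` below x by [].
  by apply: eq_imagel => y /fg.
have [h hE] := wf_recursion t0 Gext.
have hP x : D x -> B (h x) /\ ~ (h @` below x) (h x).
  move=> Dx; rewrite hE /G; case: pselect => [p|np].
    by case: (cid2 p).
  exfalso; apply: (Bbig _ Dx); apply: card_le_trans (card_image_le h _).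
  apply: subset_card_le => t Bt; apply: contrapT => nt.
  by apply: np; exists t.
apply: (card_le_inj (f := h)) => [x y|_ [x Dx <-]]; last by case: (hP x Dx).
rewrite !inE => Dx Dy hxy.
have [xy|yx|//] := ltgtP x y.
- by case: (hP y Dy) => _ []; exists x.
- by case: (hP x Dx) => _ []; exists y.
Qed.

(** This provides the index [zeta < kappa] that the guessing principles ask for. *)
Lemma card_lt_below T (B : set T) kappa :
  card_lt B (below kappa) -> exists2 x, x < kappa & B #<= below x.
Proof.
case=> _ nB; apply: contrapT => nx; apply: nB; apply: segment_card_le.
  by move=> x y /= xk yx; apply: lt_trans xk.
by move=> x xk Bx; apply: nx; exists x.
Qed.

Lemma cf_bounded D B x :
  cf D x -> B `<=` D -> B #<= below x -> exists2 y, D y & forall b, B b -> b < y.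
Proof.
move=> cfx BD Bx; apply: contrapT => nb; apply: (cfx B) => //; split=> // y Dy.
apply: contrapT => ny; apply: nb; exists y => // b Bb.
by rewrite ltNge; apply/negP => yb; apply: ny; exists b.
Qed.

Lemma S_ge_bounded kappa delta B :
  S_ge kappa delta -> B `<=` below delta -> card_lt B (below kappa) ->
  exists2 y, y < delta & forall b, B b -> b < y.
Proof.
by move=> kd Bd /card_lt_below[x /kd cfx Bx]; apply: cf_bounded cfx Bd Bx.
Qed.

Lemma card_lt_le T U V (A : set T) (B : set U) (K : set V) :
  A #<= B -> card_lt B K -> card_lt A K.
Proof.
move=> AB [BK nKB]; split; first exact: card_le_trans AB BK.
by move=> /card_le_trans/(_ AB).
Qed.

Lemma card_lt_image T U V (f : T -> U) (A : set T) (K : set V) :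
  card_lt A K -> card_lt (f @` A) K.
Proof. exact/card_lt_le/card_image_le. Qed.

Lemma set1_card_lt kappa x : `I_2 #<= below kappa -> card_lt [set x] (below kappa).
Proof.
move=> k2; have small : [set x] #<= `I_1.
  by apply: (card_le_inj (f := fun=> 0%N)) => [y z|_ [y _ <-]] //; rewrite !inE => -> ->.
apply: (card_lt_le small); split.
  by apply: card_le_trans k2; rewrite card_le_II.
by move=> /(card_le_trans k2); rewrite card_le_II.
Qed.

(** As [kappa] is at least 2, the empty set and singletons are small enough to be strictly bounded
    in [delta]. *)
Lemma S_ge_limit kappa delta :
  `I_2 #<= below kappa -> S_ge kappa delta -> limit_ordinal delta.
Proof.
move=> k2 kd.
have bnd B : B `<=` below delta -> B #<= [set kappa] ->
    exists2 y, y < delta & forall b, B b -> b < y.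
  by move=> Bd B1; apply: (S_ge_bounded kd) => //; apply: card_lt_le B1 (set1_card_lt _ k2).
split=> [|x xd].
  by have [|y yd _] := bnd set0 _ (card_ge0 _ _) => //; exists y.
have [||y yd /(_ x erefl)] := bnd [set x]; last by exists y.
- by move=> _ ->.
- by apply: (card_le_inj (f := fun=> kappa)) => [y z|_ [y _ <-]] //; rewrite !inE => -> ->.
Qed.

Lemma supremums_belowP A a :
  supremums (A `&` below a) a <-> forall x, x < a -> exists y, [/\ A y, x < y & y < a].
Proof.
split=> [[_ la] x xa|H].
  apply: contrapT => nx; have /la : ubound (A `&` below a) x.
    move=> y [Ay ya]; rewrite leNgt; apply/negP => xy; apply: nx; by exists y.
  by rewrite leNgt xa.
split=> [y [_ /ltW//]|x ux].
rewrite leNgt; apply/negP => /H[y [Ay xy ya]].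
by have := ux y (conj Ay ya); rewrite leNgt xy.
Qed.

(** Otherwise [C] would be unbounded in [gamma], hence contain it by closure. *)
Lemma club_gap C b gamma :
  club C (below b) -> gamma < b -> limit_ordinal gamma -> ~ C gamma ->
  exists2 x, x < gamma & forall y, C y -> x < y -> gamma <= y.
Proof.
move=> [_ Ccl] gb [[g0 g0g] _] nC; apply: contrapT => nx; apply: nC.
have H x : x < gamma -> exists y, [/\ C y, x < y & y < gamma].
  move=> xg; apply: contrapT => ny; apply: nx; exists x => // y Cy xy.
  by rewrite leNgt; apply/negP => yg; apply: ny; exists y.
apply: Ccl => //; last exact/supremums_belowP.
by have [y [Cy _ yg]] := H _ g0g; exists y.
Qed.

(** * Bounded sets and clubs in a regular uncountable ordinal *)

Section RegularUncountable.
Context (L_regular : regular [set: L]) (L_uncountable : ~ countable [set: L]).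

Lemma bounded_of_card_le B x : B #<= below x -> exists y, forall b, B b -> b < y.
Proof.
case: L_regular => _ _ cfL Bx; have [|//|y _ By] := @cf_bounded setT B x _ _ Bx.
  by rewrite cfL.
by exists y.
Qed.

Lemma exists_gt x : exists y, x < y.
Proof.
have [[y [z zy]]|nyz] := pselect (exists y z, z < y).
  have [|u /(_ x erefl)] := @bounded_of_card_le [set x] y; last by exists u.
  by apply: (card_le_inj (f := fun=> z)) => [? ?|_ [? _ <-]] //; rewrite !inE => -> ->.
case: L_regular => _ Linf _; exfalso; apply: Linf.
apply: (sub_finite_set _ (finite_set1 x)) => y _ /=.
by have [xy|yx|//] := ltgtP y x; exfalso; apply: nyz; [exists x, y|exists y, x].
Qed.

Lemma bounded_le x : exists z, [set y | y <= x] `<=` below z.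
Proof.
by have [z xz] := exists_gt x; exists z => y /= /le_lt_trans; apply.
Qed.

Lemma bounded_image_le (f : L -> L) x : exists z, x < z /\ forall y, y <= x -> f y < z.
Proof.
have [z xz] := bounded_le x.
have [|u fu] := @bounded_of_card_le (f @` [set y | y <= x]) z.
  exact: card_le_trans (card_image_le _ _) (subset_card_le xz).
have [v xv] := exists_gt x.
exists (Order.max u v); rewrite lt_max xv orbT; split=> // y yx.
by rewrite lt_max fu //; exists y.
Qed.

Lemma bounded_countable B : countable B -> exists z, forall b, B b -> b < z.
Proof.
move=> Bc; have [[x nx]|allc] := pselect (exists x, ~ countable (below x)).
  apply: (@bounded_of_card_le _ x); apply: card_le_trans Bc _.
  by apply/infiniteP => /finite_set_countable.
(* Now all segments are countable, so an unbounded countable [B] would make [L] a countable union of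
   countable sets. *)
apply: contrapT => nb; apply: L_uncountable.
have -> : [set: L] = \bigcup_(b in B) below b.
  apply/seteqP; split=> // y _; apply: contrapT => ny; apply: nb.
  have [z yz] := exists_gt y; exists z => b Bb; rewrite ltNge; apply/negP => zb.
  by apply: ny; exists b => //=; apply: lt_le_trans yz zb.
by apply: bigcup_countable => // b _; apply: contrapT => nb'; apply: allc; exists b.
Qed.

Lemma club_closure_points (f : L -> L) :
  club [set g | forall y, y < g -> f y < g] [set: L].
Proof.
split; last first.
  move=> a _ _ /supremums_belowP sa y /= ya.
  by have [e [Ee ye ea]] := sa _ ya; apply: lt_trans ea; apply: Ee.
split=> // x _.
have [next nextP] := choice (bounded_image_le f).
pose u n := iter n next x.
have [z uz] := bounded_countable (card_le_trans (card_image_le u setT) (card_lexx _)).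
(* [m] is the supremum of the iterates: whatever lies below it is at most some [u n], and its image
   under [f] is below [u n.+1]. *)
have [|m mP mmin] := least_element (A := [set z | forall n, u n < z]).
  by exists z => n; apply: uz; exists n.
exists m; last exact/ltW/(mP 0).
move=> y ym /=.
have [n yn] : exists n, y <= u n.
  apply: contrapT => nn; suff : m <= y by rewrite leNgt ym.
  by apply: mmin => n; rewrite ltNge; apply/negP => yn; apply: nn; exists n.
by apply: lt_trans (mP n.+1); apply: (nextP (u n)).2.
Qed.

Lemma club_unbounded E : club E [set: L] -> forall x, exists2 e, E e & x < e.
Proof.
move=> [[_ Eu] _] x; have [y xy] := exists_gt x.
by have [e Ee ye] := Eu y I; exists e => //; apply: lt_le_trans ye.
Qed.

Lemma unbounded_card_eq B : (forall x, exists2 y, B y & x < y) -> B #= [set: L].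
Proof.
move=> Bu; rewrite card_eq_le card_leT; apply: segment_card_le => // x _.
move=> /bounded_of_card_le[z Bz]; have [y By] := Bu z.
by rewrite ltNge (ltW (Bz y By)).
Qed.

End RegularUncountable.

(** * Walks along ladders *)

Section Walk.
Context (C : L -> set L) (C_cofinal : forall b, cofinal (C b) (below b)).

Lemma walk_length_exists : exists rho : L -> L -> nat, forall a b x,
  a < b -> C b x -> a <= x -> (forall y, C b y -> a <= y -> x <= y) ->
  rho a b = (rho a x).+1.
Proof.
suff H a : exists r : L -> nat, forall b x,
    a < b -> C b x -> a <= x -> (forall y, C b y -> a <= y -> x <= y) ->
    r b = (r x).+1.
  by have [rho rhoP] := choice H; exists rho.
(* When no ladder point is at least [a], [xget] returns [b] itself and the walk stops with length
   0. *)
pose step b := xget b (C b `&` [set x | a <= x] `&` lbound (C b `&` [set x | a <= x])).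
pose G b (r : L -> nat) := if pselect (step b < b) then (r (step b)).+1 else 0%N.
have Gext b r s : (forall y, y < b -> r y = s y) -> G b r = G b s.
  by move=> rs; rewrite /G; case: pselect => // p; rewrite rs.
have [r rP] := wf_recursion 0%N Gext; exists r => b x ab Cx ax xmin.
have xb : x < b by case: (C_cofinal b) => /(_ x Cx).
suff sx : step b = x by rewrite rP /G sx; case: pselect.
have xP : (C b `&` [set x | a <= x] `&` lbound (C b `&` [set x | a <= x])) x.
  by split=> // y [Cy ay]; apply: xmin.
have := xgetI b xP; rewrite -/(step b) => -[[Cs as_] smin].
by apply/le_anti; rewrite smin // xmin.
Qed.

(** The ladder of [b] misses the ordinals strictly between [x] and [gamma], so all walks to them
    share their first step: the least ladder point from [gamma] on. *)
Lemma walk_jump (rho : L -> L -> nat) :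
  (forall a b x,
    a < b -> C b x -> a <= x -> (forall y, C b y -> a <= y -> x <= y) ->
    rho a b = (rho a x).+1) ->
  forall b gamma x, x < gamma -> gamma < b ->
  (forall y, C b y -> x < y -> gamma <= y) ->
  exists b', [/\ gamma <= b', b' < b &
    forall a, x < a -> a < gamma -> rho a b = (rho a b').+1].
Proof.
move=> rhoP b g x xg gb gap.
have [|m [Cm gm] mmin] := least_element (A := C b `&` [set y | g <= y]).
  by case: (C_cofinal b) => _ /(_ g gb)[y Cy gy]; exists y.
exists m; split=> //; first by case: (C_cofinal b) => /(_ m Cm).
move=> a xa ag; apply: rhoP => //.
- exact: lt_trans gb.
- exact/ltW/(lt_le_trans ag).
- by move=> y Cy ay; apply: mmin; split=> //; apply: gap => //; apply: lt_le_trans ay.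
Qed.

End Walk.

(** * From guessing and walks to the colouring *)

Definition unbounded_colouring kappa (c : L -> L -> nat) : Prop :=
  (forall a b : L, c a b = c b a) /\
  (forall (w : L -> set L) (n : nat),
     (forall i : L, w i !=set0) ->
     trivIset [set: L] w ->
     (forall i : L, card_lt (w i) (below kappa)) ->
     exists Y : set L,
       Y #= [set: L] /\
       (forall i j : L, Y i -> Y j -> i < j ->
          (forall a b : L, w i a -> w j b -> a < b) /\
          (forall a b : L, w i a -> w j b -> (n < c a b)%N))).

(* [T] stands for the index set of the given sequence: limit ordinals in the
   case of oplus, inaccessibles in the case of otimes.  Outside [T] the ladders
   are ours to choose, and [C_gap] says that they never accumulate at a point
   of [T]. *)
Section Colouring.
Context (L_regular : regular [set: L]) (L_uncountable : ~ countable [set: L]).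
Context (kappa : L) (kappa_ge2 : `I_2 #<= below kappa).
Context (T : set L) (C : L -> set L).
Context (C_cofinal : forall b, cofinal (C b) (below b)).
Context (C_club : forall b, T b -> club (C b) (below b)).
Context (C_gap : forall delta b,
  T delta -> limit_ordinal delta -> delta < b -> ~ T b ->
  exists2 x, x < delta & forall y, C b y -> x < y -> delta <= y).
Context (guess : forall E, club E [set: L] -> exists delta,
  [/\ T delta, S_ge kappa delta &
      forall zeta (alpha : L -> L) x,
        zeta < kappa -> (forall eps, eps < zeta -> T (alpha eps)) -> x < delta ->
        exists gamma, [/\ E gamma, S_ge kappa gamma, x < gamma, gamma < delta &
          forall eps, eps < zeta -> ~ C (alpha eps) gamma]]).
Context (rho : L -> L -> nat).
Context (rhoP : forall a b x,
  a < b -> C b x -> a <= x -> (forall y, C b y -> a <= y -> x <= y) ->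
  rho a b = (rho a x).+1).

(** The walk is followed until it enters [T], at [delta] at the latest; [C_gap] makes each step
    independent of the target near [delta]. *)
Lemma walk_descend delta b : T delta -> limit_ordinal delta -> delta <= b ->
  exists b', [/\ T b', delta <= b' & exists2 x, x < delta &
    forall a, x < a -> a < delta -> (rho a b' <= rho a b)%N].
Proof.
move=> Td dlim; have [[x0 x0d] _] := dlim.
elim/(well_founded_ind L_wf): b => b IH db.
have [Tb|nTb] := pselect (T b); first by exists b; split=> //; exists x0.
have {}db : delta < b.
  by rewrite lt_neqAle db andbT; apply/eqP => dbE; apply: nTb; rewrite -dbE.
have [x xd gap] := C_gap Td dlim db nTb.
have [b1 [db1 b1b jump]] := walk_jump C_cofinal rhoP xd db gap.
have [b' [Tb' db' [x' x'd le']]] := IH b1 b1b db1.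
exists b'; split=> //; exists (Order.max x x'); first by rewrite gt_max xd.
move=> a; rewrite gt_max => /andP[xa x'a] ad.
by rewrite jump //; apply: leqW; apply: le'.
Qed.

(* Pressing down is replaced by choosing [delta] and [gamma] in the club of
   closure points of a function [f] bounding the counterexamples. *)
Lemma walk_longer (w : L -> set L) :
  (forall x b, w x b -> x < b) -> (forall x, card_lt (w x) (below kappa)) ->
  exists eta, forall x, exists y (h : L -> L), x <= y /\ forall b, w y b ->
    x < h b /\ forall a, eta < a -> a < x -> (rho a (h b) < rho a b)%N.
Proof.
move=> wgt wsmall; apply: contrapT => neta.
(* The threshold [eta] fails at [x = f eta]: no [y >= f eta] has a suitable [h]. *)
have /choice[f fP] : forall eta, exists x, forall y (h : L -> L), x <= y ->
    ~ forall b, w y b ->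
      x < h b /\ forall a, eta < a -> a < x -> (rho a (h b) < rho a b)%N.
  move=> eta; apply: contrapT => nx; apply: neta; exists eta => x.
  apply: contrapT => ny; apply: nx; exists x => y h xy H.
  by apply: ny; exists y, h.
have [delta [Td dk Hd]] := guess (club_closure_points L_regular L_uncountable f).
have dlim := S_ge_limit kappa_ge2 dk.
(* The pair consists of the ordinal of [T] reached from [b] and a bound below [delta]; [(b, b)] is a
   dummy value. *)
have /choice[g gP] : forall b, exists p : L * L, w delta b ->
    [/\ T p.1, delta <= p.1, p.2 < delta &
      forall a, p.2 < a -> a < delta -> (rho a p.1 <= rho a b)%N].
  move=> b; have [wb|] := pselect (w delta b); last by exists (b, b).
  have [b' [Tb' db' [x xd H]]] := walk_descend Td dlim (ltW (wgt _ _ wb)).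
  by exists (b', x).
have [|x1 x1d x1P] := S_ge_bounded dk (B := (fun b => (g b).2) @` w delta) _
    (card_lt_image _ (wsmall delta)).
  by move=> _ [b wb <-]; case: (gP b wb).
have [zeta zk Bz] := card_lt_below (card_lt_image (fun b => (g b).1) (wsmall delta)).
have [alpha0 alpha0P] := card_le_cover delta Bz.
(* [guess] needs a sequence in [T], so stray values are replaced by [delta]. *)
pose alpha e := if pselect (T (alpha0 e)) then alpha0 e else delta.
have [gamma [Eg gk x1g gd gC]] : exists gamma,
    [/\ (forall y, y < gamma -> f y < gamma), S_ge kappa gamma, x1 < gamma, gamma < delta &
      forall eps, eps < zeta -> ~ C (alpha eps) gamma].
  by apply: Hd => // e _; rewrite /alpha; case: pselect.
have glim := S_ge_limit kappa_ge2 gk.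
have /choice[k kP] : forall b, exists p : L * L, w delta b ->
    [/\ gamma <= p.1, p.2 < gamma &
      forall a, p.2 < a -> a < gamma -> rho a (g b).1 = (rho a p.1).+1].
  move=> b; have [wb|] := pselect (w delta b); last by exists (b, b).
  have [Tb db _ _] := gP b wb; have gb := lt_le_trans gd db.
  have nC : ~ C (g b).1 gamma.
    have [|e ez eb] := alpha0P (g b).1; first by exists b.
    by have := gC e ez; rewrite /alpha eb; case: pselect.
  have [x xg gap] := club_gap (C_club Tb) gb glim nC.
  have [b' [gb' _ jump]] := walk_jump C_cofinal rhoP xg gb gap.
  by exists (b', x).
have [|x2 x2g x2P] := S_ge_bounded gk (B := (fun b => (k b).2) @` w delta) _
    (card_lt_image _ (wsmall delta)).
  by move=> _ [b wb <-]; case: (kP b wb).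
(* The choice of [f] is contradicted at [eta = max x1 x2], with [delta] as [y]; closure of [gamma]
   under [f] gives [f eta < gamma]. *)
have etag : Order.max x1 x2 < gamma by rewrite gt_max x1g.
have fg := Eg _ etag.
apply: (fP (Order.max x1 x2) delta (fun b => (k b).1)).
  exact/ltW/(lt_trans fg).
move=> b wb; have [_ _ _ gb] := gP b wb; have [gkb _ kb] := kP b wb.
split=> [|a]; first exact: lt_le_trans gkb.
rewrite gt_max => /andP[x1a x2a] af; have ag := lt_trans af fg.
rewrite -kb //; last by apply: lt_trans x2a; apply: x2P; exists b.
apply: gb; last exact: lt_trans gd.
by apply: lt_trans x1a; apply: x1P; exists b.
Qed.

Lemma walk_long n (w : L -> set L) :
  (forall x b, w x b -> x < b) -> (forall x, card_lt (w x) (below kappa)) ->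
  exists eta, forall x, exists2 y, x <= y & forall b, w y b ->
    forall a, eta < a -> a < x -> (n <= rho a b)%N.
Proof.
elim: n w => [|n IH] w wgt wsmall; first by exists kappa => x; exists x.
have [eta1 /choice[y /choice[h yh]]] := walk_longer wgt wsmall.
(* The induction applies to the family of the points [h x b], the walks from which are at least one
   step shorter. *)
have [||eta2 eta2P] := IH (fun x => h x @` w (y x)).
- by move=> x _ [b wb <-]; case: (yh x) => _ /(_ b wb)[].
- by move=> x; apply: card_lt_image.
exists (Order.max eta1 eta2) => x; have [z xz zP] := eta2P x.
have [zy hz] := yh z; exists (y z); first exact: le_trans zy.
move=> b wb a; rewrite gt_max => /andP[a1 a2] ax.
have [_ /(_ a a1 (lt_le_trans ax xz))] := hz b wb.
by apply: leq_ltn_trans; apply: zP => //; exists b.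
Qed.

Lemma colouring_of_walks : exists c, unbounded_colouring kappa c.
Proof.
rewrite /unbounded_colouring; exists (fun a b => rho (Order.min a b) (Order.max a b)); split=> [a b|w n w0 wI wsmall].
  by rewrite minC maxC.
(* By disjointness, choosing a point at most [x] in each [w i] that has one is injective, so the
   indices of such sets are bounded. *)
have /choice[i iP] : forall x, exists i, x < i /\ forall b, w i b -> x < b.
  move=> x; have [z xz] := bounded_le L_regular x.
  pose B := [set i | exists2 b, w i b & b <= x].
  have /bounded_of_card_le[//|z' Bz'] : B #<= below z.
    have /choice[p pP] : forall i, exists b, B i -> w i b /\ b <= x.
      move=> i; have [[b]|] := pselect (B i); first by exists b.
      by exists i.
    apply: (card_le_inj (f := p)) => [i j|_ [i Bi <-]]; last first.
      by apply: xz; case: (pP i Bi).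
    rewrite !inE => Bi Bj pij; apply: wI => //.
    by exists (p i); split; [case: (pP i Bi)|rewrite pij; case: (pP j Bj)].
  have [u xu] := exists_gt L_regular (Order.max x z').
  move: xu; rewrite gt_max => /andP[xu z'u].
  exists u; split=> // b wb; rewrite ltNge; apply/negP => bx.
  have /Bz' : B u by exists b.
  by rewrite ltNge (ltW z'u).
have [||eta etaP] := @walk_long n.+1 (w \o i).
- by move=> x b; apply: (iP x).2.
- by move=> x; apply: wsmall.
have /choice[y yP] : forall x, exists y, x <= y /\ forall b, w (i y) b ->
    forall a, eta < a -> a < x -> (n < rho a b)%N.
  by move=> x; have [y xy yP] := etaP x; exists y.
have xy x : x <= y x by case: (yP x).
(* Bounding the index as well as the set lets [Emono] recover the order of [x] and [x'] from that of
   their indices. *)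
have sP x : exists s, i (y x) < s /\ forall b, w (i (y x)) b -> b < s.
  have [k _ wk] := card_lt_below (wsmall (i (y x))).
  have [s ws] := bounded_of_card_le L_regular wk.
  have [t it] := exists_gt L_regular (i (y x)).
  exists (Order.max s t); rewrite lt_max it orbT; split=> // b wb.
  by rewrite lt_max ws.
have [s {}sP] := choice sP.
(* For [x < x'] in [E], the set chosen for [x] lies between [eta] and [x'], where walks from the set
   chosen for [x'] are long. *)
pose E := [set g | eta < g /\ forall z, z < g -> s z < g].
have Emono x x' : E x -> E x' -> i (y x) < i (y x') -> x < x'.
  move=> [_ Ex] _ ixx; rewrite ltNge; apply/negP; rewrite le_eqVlt => /predU1P[e|x'x].
    by move: ixx; rewrite e ltxx.
  have := lt_trans (lt_trans (sP x').1 (Ex _ x'x)) (le_lt_trans (xy x) (iP (y x)).1).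
  by rewrite ltNge (ltW ixx).
exists ((fun x => i (y x)) @` E); split.
  apply: unbounded_card_eq => // x.
  have [e Ee] := club_unbounded L_regular
    (club_closure_points L_regular L_uncountable s) (Order.max eta x).
  rewrite gt_max => /andP[etae xe].
  exists (i (y e)); first by exists e.
  by apply: (lt_trans xe); apply: le_lt_trans (xy e) (iP _).1.
move=> _ _ [x Ex <-] [x' Ex' <-] /(Emono _ _ Ex Ex')xx'.
have H a b : w (i (y x)) a -> w (i (y x')) b -> [/\ eta < a, a < x' & a < b].
  move=> wa wb; have ax' : a < x'.
    by apply: lt_trans ((sP x).2 a wa) _; apply: Ex'.2.
  split=> //.
    by apply: (lt_trans Ex.1); apply: le_lt_trans (xy x) ((iP _).2 _ wa).
  by apply: (lt_trans ax'); apply: le_lt_trans (xy x') ((iP _).2 _ wb).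
split=> a b wa wb; have [ea ax' ab] := H a b wa wb => //.
by rewrite (min_idPl (ltW ab)) (max_idPr (ltW ab)); apply: (yP x').2 wb a ea ax'.
Qed.

End Colouring.

(** * Ladders and guessing from [oplus] and [otimes] *)

(** For a successor the set is the singleton of its predecessor, for 0 it is empty. *)
Lemma cofinal_not_limit b :
  ~ limit_ordinal b -> cofinal (below b `&` ubound (below b)) (below b).
Proof.
move=> nlim; split=> [x []//|x xb].
have [z zb zmax] : exists2 z, z < b & forall y, y < b -> y <= z.
  apply: contrapT => nz; apply: nlim; split=> [|z zb]; first by exists x.
  apply: contrapT => ny; apply: nz; exists z => // y yb.
  by rewrite leNgt; apply/negP => zy; apply: ny; exists y.
by exists z; last exact: zmax.
Qed.

(* The set is a final segment of [b] lying above all inaccessibles below [b],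
   except when [b] is a singular cardinal: then it is a cofinal set of
   cardinality at most its minimum. *)
Lemma cofinal_not_inaccessible b : ~ S_in b -> exists2 A, cofinal A (below b) &
  forall delta, S_in delta -> limit_ordinal delta -> delta < b ->
    exists2 x, x < delta & forall y, A y -> x < y -> delta <= y.
Proof.
move=> nb.
have tail a : a < b -> (forall delta, S_in delta -> delta < b -> delta <= a) ->
    exists2 A, cofinal A (below b) &
    forall delta, S_in delta -> limit_ordinal delta -> delta < b ->
      exists2 x, x < delta & forall y, A y -> x < y -> delta <= y.
  move=> ab da; exists [set y | a <= y /\ y < b].
    split=> [y []//|x xb]; exists (Order.max a x); last by rewrite le_max lexx orbT.
    by split; rewrite ?le_max ?lexx // gt_max ab.
  move=> delta din [[x xd] _] db; exists x => // y [ay _] _.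
  exact: le_trans (da _ din db) ay.
have [bc|bc] := pselect (countable (below b)).
  exists (below b) => [|delta [duncount _ _] _ db]; first by split=> // x xb; exists x.
  exfalso; apply: duncount; apply: sub_countable bc; apply: subset_card_le => x /= xd.
  exact: lt_trans db.
have binf : infinite_set (below b) by move=> /finite_set_countable.
(* If [b] is not a cardinal, it has the size of some [a < b], and no cardinal lies strictly between
   them. *)
have [bcard|] := pselect (is_cardinal (below b)); last first.
  move=> /existsNP[a /not_implyP[ab /contrapT aE]]; apply: (tail a) => // delta din db.
  rewrite leNgt; apply/negP => ad; case: din => _ [dcard _ _] _.
  apply: (dcard a ad); rewrite card_eq_le; apply/andP; split.
    by apply: subset_card_le => x /= xa; apply: lt_trans ad.
  rewrite (card_le_eqr aE); apply: subset_card_le => x /= xd; exact: lt_trans db.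
have cfb : cf (below b) `<=` below b.
  move=> x /(_ (below b)) H; rewrite /below /= ltNge; apply/negP => bx; apply: H.
    by split=> // y yb; exists y.
  by apply: subset_card_le => y /= yb; apply: lt_le_trans bx.
have [breg|breg] := pselect (cf (below b) = below b).
  have [blim|] := pselect (limit_cardinal (below b)); first by exfalso; apply: nb.
  (* Here [b] is the successor cardinal of [a]. *)
  move=> /not_andP[//|/existsNP[a /not_implyP[ab /not_implyP[acard na]]]].
  apply: (tail a) => // delta din db; rewrite leNgt; apply/negP => ad; apply: na.
  by exists delta; split=> //; case: din => _ [].
have [x xb [A Acof /contrapT Ax]] : exists2 x, x < b &
    exists2 A, cofinal A (below b) & ~ ordcard A x.
  apply: contrapT => nx; apply: breg; apply/seteqP; split=> // x xb A Acof.
  by apply: contrapT => nA; apply: nx; exists x => //; exists A.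
have [Ab Au] := Acof.
exists (A `&` [set y | x <= y]).
  split=> [y [/Ab]//|z zb].
  have [|y Ay] := Au (Order.max x z); first by rewrite /below /= gt_max xb.
  by rewrite ge_max => /andP[xy zy]; exists y.
move=> delta [_ [_ _ dreg] _] [[x0 x0d] _] db.
have [dx|xd] := leP delta x.
  by exists x0 => // y [_ xy] _; apply: le_trans xy.
(* [delta > x] is regular and [A] has at most the size of [x], so [A] is bounded below [delta]. *)
have [|||y yd yP] := @cf_bounded (below delta) (A `&` below delta) x.
- by rewrite dreg.
- by move=> ? [].
- by apply: card_le_trans Ax; apply: subset_card_le => ? [].
exists y => // z [Az _] yz; rewrite leNgt; apply/negP => zd.
by have := yP z (conj Az zd); rewrite ltNge (ltW yz).
Qed.

Lemma colouring_of_oplus kappa :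
  regular [set: L] -> ~ countable [set: L] -> `I_2 #<= below kappa -> oplus kappa ->
  exists c, unbounded_colouring kappa c.
Proof.
move=> Lreg Luncount k2 [C [Cclub Cguess]].
pose C' b := if pselect (S_lim b) then C b else below b `&` ubound (below b).
have C'E b : S_lim b -> C' b = C b by rewrite /C'; case: pselect.
have C'N b : ~ S_lim b -> C' b = below b `&` ubound (below b).
  by rewrite /C'; case: pselect.
have C'cof b : cofinal (C' b) (below b).
  have [lb|nlb] := pselect (S_lim b); first by rewrite C'E //; case: (Cclub b lb).
  by rewrite C'N //; apply: cofinal_not_limit.
have [rho rhoP] := walk_length_exists C'cof.
apply: (@colouring_of_walks Lreg Luncount kappa k2 S_lim C' C'cof _ _ _ rho rhoP).
- by move=> b lb; rewrite C'E //; apply: Cclub.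
- move=> delta b _ [[x xd] _] db nlb; rewrite C'N //.
  by exists x => // y [_ yub] _; apply: yub.
move=> E /Cguess[delta [_ dk nbd]]; exists delta; split=> //; first exact: S_ge_limit dk.
(* If the ladders covered all candidates above [x], then [x] would bound the uncovered ones. *)
move=> zeta alpha x zk lalpha xd; apply: contrapT => nex; apply: nbd.
exists zeta, alpha; split=> //; exists x => // g [[[gk Eg] gd] gC].
rewrite leNgt; apply/negP => xg; apply: nex; exists g; split=> // e ez.
by rewrite C'E; [move=> Ce; apply: gC; exists e|apply: lalpha].
Qed.

(** Stationarity gives an inaccessible in [E] above [x] and [kappa]; being regular, it is its own
    cofinality. *)
Lemma cofinality_club kappa E : is_Mahlo L -> club E [set: L] ->
  forall x, exists2 e, (E `&` S_ge kappa) e & x < e.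
Proof.
move=> [[Luncount Lreg _] [_ stat]] [[_ Eu] Ecl] x.
have [|delta [din [Ed]]] := stat (E `&` [set e | Order.max x kappa < e]).
  split=> [|a _ [e [[Ee xe] ea]] /supremums_belowP sa].
    split=> // y _; have [z] := exists_gt Lreg (Order.max y (Order.max x kappa)).
    rewrite gt_max => /andP[yz xz]; have [e Ee ze] := Eu z I.
    by exists e; [split=> //; apply: lt_le_trans ze|apply: le_trans ze; apply: ltW].
  split; last exact: lt_trans ea.
  apply: Ecl => //; first by exists e.
  by apply/supremums_belowP => y /sa[e' [[Ee' _] ye ea']]; exists e'.
rewrite /= gt_max => /andP[xd kd]; exists delta => //; split=> //.
case: din => _ [_ _ dreg] _; rewrite /S_ge /= dreg => y /= yk; exact: lt_trans kd.
Qed.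

Lemma club_adherence E : (forall x, exists2 e, E e & x < e) ->
  club [set a | E a \/ E `&` below a !=set0 /\ supremums (E `&` below a) a] [set: L].
Proof.
move=> Eu; split=> [|a _ [e [Ee ea]] /supremums_belowP sa].
  split=> // x _; have [e Ee xe] := Eu x; exists e; [by left|exact: ltW].
have H x : x < a -> exists y, [/\ E y, x < y & y < a].
  move=> /sa[y [[Ey|[_ /supremums_belowP sy]] xy ya]]; first by exists y.
  by have [z [Ez xz zy]] := sy _ xy; exists z; split=> //; apply: lt_trans ya.
right; split; last exact/supremums_belowP.
by have [y [Ey _ ya]] := H _ ea; exists y.
Qed.

(** A limit of [E] is an accumulation point of the larger set, so what remains in [nacc] comes from
    [E]. *)
Lemma nacc_adherence E :
  nacc [set a | E a \/ E `&` below a !=set0 /\ supremums (E `&` below a) a] `<=` E.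
Proof.
move=> a [[//|[E0 /supremums_belowP sa] na]]; exfalso; apply: na.
split; first by right; split=> //; apply/supremums_belowP.
by apply/supremums_belowP => x /sa[y [Ey xy ya]]; exists y; split=> //; left.
Qed.

Lemma colouring_of_otimes kappa :
  is_Mahlo L -> `I_2 #<= below kappa -> otimes kappa ->
  exists c, unbounded_colouring kappa c.
Proof.
move=> Mahlo k2 [C [Cclub Cguess]]; have [[Luncount Lreg _] _] := Mahlo.
have /choice[D DP] : forall b, exists A, ~ S_in b -> cofinal A (below b) /\
    forall delta, S_in delta -> limit_ordinal delta -> delta < b ->
      exists2 x, x < delta & forall y, A y -> x < y -> delta <= y.
  move=> b; have [|/cofinal_not_inaccessible[A]] := pselect (S_in b); last by exists A.
  by exists setT.
pose C' b := if pselect (S_in b) then C b else D b.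
have C'E b : S_in b -> C' b = C b by rewrite /C'; case: pselect.
have C'N b : ~ S_in b -> C' b = D b by rewrite /C'; case: pselect.
have C'cof b : cofinal (C' b) (below b).
  have [lb|nlb] := pselect (S_in b); first by rewrite C'E //; case: (Cclub b lb).
  by rewrite C'N //; case: (DP b nlb).
have [rho rhoP] := walk_length_exists C'cof.
apply: (@colouring_of_walks Lreg Luncount kappa k2 S_in C' C'cof _ _ _ rho rhoP).
- by move=> b lb; rewrite C'E //; apply: Cclub.
- move=> delta b din dlim db nlb; rewrite C'N //.
  by case: (DP b nlb) => _; apply.
move=> E /(cofinality_club kappa Mahlo)/[dup] /club_adherence/Cguess.
move=> [delta [_ din dk nbd]] _; exists delta; split=> //.
move=> zeta alpha x zk lalpha xd; apply: contrapT => nex; apply: nbd.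
exists zeta, alpha; split=> //; exists x => // g [[/nacc_adherence[Eg gk] gd] gC].
rewrite leNgt; apply/negP => xg; apply: nex; exists g; split=> // e ez.
by rewrite C'E; [move=> Ce; apply: gC; exists e|apply: lalpha].
Qed.

End WellOrder.

Theorem claim21p3 (d : Order.disp_t) (L : orderType d)
    (L_wf : well_founded (fun x y : L => x < y))
    (L_regular : regular [set: L]) (L_uncountable : ~ countable [set: L])
    (kappa : L) (kappa_cardinal : is_cardinal (below kappa))
    (kappa_ge2 : `I_2 #<= below kappa)
    (H : (is_Mahlo L /\ otimes kappa) \/ oplus kappa) :
  exists c : L -> L -> nat,
    (forall a b : L, c a b = c b a) /\
    (forall (w : L -> set L) (n : nat),
       (forall i : L, w i !=set0) ->
       trivIset [set: L] w ->
       (forall i : L, card_lt (w i) (below kappa)) ->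
       exists Y : set L,
         Y #= [set: L] /\
         (forall i j : L, Y i -> Y j -> i < j ->
            (forall a b : L, w i a -> w j b -> a < b) /\
            (forall a b : L, w i a -> w j b -> (n < c a b)%N))).
Proof.
case: H => [[Mahlo H]|H]; first exact: colouring_of_otimes H.
exact: colouring_of_oplus H.
Qed.
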